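(* The commutator subgroup $G=[B_{\infty},B_{\infty}]$ of the infinite braid group satisfies the following three conditions: (1) $G$ has finite abelianisation; (2) the commutator length of $G$ is stably trivial, i.e. $\lim_{k\to\infty}\operatorname{cl}_G(g^k)/k=0$ for every $g\in[G,G]$; (3) $G$ admits a stably unbounded conjugation invariant norm.
   Context: $B_n$ is the braid group on $n$ strings, and $B_\infty=\bigcup_n B_n$ with respect to the inclusions $B_n\to B_{n+1}$ onto the first $n$ strings. For $g\in[G,G]$, the commutator length $\operatorname{cl}_G(g)$ is the minimal number of commutators of elements of $G$ whose product is $g$. A norm on a group $G$ is a function $\nu\colon G\to\mathbb{R}$ with $\nu(g)\ge0$, $\nu(g)=\nu(g^{-1})$, $\nu(gh)\le\nu(g)+\nu(h)$ for all $g,h$, and $\nu(g)=0$ if and only if $g=1$; it is conjugation invariant if $\nu(ghg^{-1})=\nu(h)$ for all $g,h$, and stably unbounded if there exists $g\in G$ with $\lim_{p\to\infty}\nu(g^p)/p\ne0$. *)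

(* Defs.v *)
From HB Require Import structures.
From mathcomp Require Import all_boot all_order all_algebra.
From mathcomp Require Import all_classical all_reals all_analysis.
Import numFieldNormedType.Exports.

Set Implicit Arguments.
Unset Strict Implicit.
Unset Printing Implicit Defensive.

Local Open Scope classical_set_scope.
Local Open Scope quotient_scope.
Local Open Scope group_scope.

Section CommutatorSubgroup.
Variable G : groupType.

Definition is_subgroup (A : set G) : Prop :=
  A 1 /\ (forall x y, A x -> A y -> A (x / y)).

(* The commutator of the library is [~ x, y] = x^-1 * y^-1 * x * y; since
   x * y * x^-1 * y^-1 = [~ x^-1, y^-1], both conventions yield the same set of
   commutators. *)
Definition commutators : set G := [set [~ p.1, p.2] | p in [set: G * G]].

Definition derived : set G := smallest is_subgroup commutators.

Lemma derived_subgroup : is_subgroup derived.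
Proof.
split=> [A [[A1 _] _] //|x y dx dy A subA].
by have [[_ AV] _] := subA; apply: AV; [exact: dx | exact: dy].
Qed.

Lemma derived1 : derived 1.
Proof. by have [] := derived_subgroup. Qed.

Lemma derivedF x y : derived x -> derived y -> derived (x / y).
Proof. by have [_] := derived_subgroup; apply. Qed.

Lemma derivedV x : derived x -> derived x^-1.
Proof. by move=> dx; rewrite -(mul1g x^-1); apply: derivedF derived1 dx. Qed.

Lemma derivedM x y : derived x -> derived y -> derived (x * y).
Proof. by move=> dx /derivedV dy; rewrite -(invgK y); apply: derivedF. Qed.

Lemma derivedR x y : derived [~ x, y].
Proof. by apply: sub_gen_smallest; exists (x, y). Qed.

Lemma derivedJ x y : derived x -> derived (x ^ y).
Proof.
move=> dx; rewrite (_ : x ^ y = x * [~ x, y]).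
  exact: derivedM dx (derivedR x y).
by rewrite /commg mulgA mulgV mul1g.
Qed.

Definition in_derived : {pred G} := [pred x | `[< derived x >]].

Fact in_derived_group_closed : group_closed in_derived.
Proof.
split=> [|x y]; first by apply/asboolP; exact: derived1.
by move=> /asboolP dx /asboolP dy; apply/asboolP; exact: derivedF.
Qed.

Record derived_group := DerivedGroup {
  derived_val :> G;
  _ : derived_val \in in_derived
}.

HB.instance Definition _ := [isSub for derived_val].
HB.instance Definition _ := [Choice of derived_group by <:].
HB.instance Definition _ :=
  SubChoice_isSubGroup.Build G in_derived derived_group in_derived_group_closed.

Definition abel_eq : rel G := fun x y => `[< derived (x^-1 * y) >].

Fact abel_eq_equiv : equiv_class_of abel_eq.
Proof.
split=> [x|x y|y x z]; first by apply/asboolP; rewrite mulVg; exact: derived1.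
  by apply/asboolP/asboolP => /derivedV; rewrite invgM invgK.
move=> /asboolP dxy /asboolP dyz; apply/asboolP.
have -> : x^-1 * z = x^-1 * y * (y^-1 * z) by rewrite -mulgA mulVKg.
exact: derivedM.
Qed.

Canonical abel_equiv := EquivRelPack abel_eq_equiv.

Definition abelianisation := {eq_quot abel_eq}.

HB.instance Definition _ := Choice.on abelianisation.
HB.instance Definition _ := Quotient.on abelianisation.

Lemma abel_piP (x y : G) :
  \pi_abelianisation x = \pi_abelianisation y <-> derived (x^-1 * y).
Proof.
split; first by move/(@eqquotP _ abel_equiv abelianisation)/asboolP.
by move=> dxy; apply/(@eqquotP _ abel_equiv abelianisation)/asboolP.
Qed.

Definition abel_one : abelianisation := \pi_abelianisation 1.
Definition abel_inv (a : abelianisation) : abelianisation :=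
  \pi_abelianisation ((repr a)^-1).
Definition abel_mul (a b : abelianisation) : abelianisation :=
  \pi_abelianisation (repr a * repr b).

Lemma abel_invE x : abel_inv (\pi_abelianisation x) = \pi_abelianisation x^-1.
Proof.
have /abel_piP dx : \pi_abelianisation (repr (\pi_abelianisation x)) = \pi_abelianisation x.
  by rewrite reprK.
apply/abel_piP; set y := repr _ in dx *; rewrite invgK.
have -> : y * x^-1 = ((y^-1 * x)^-1) ^ y^-1.
  by rewrite /conjg invgM !invgK mulgK.
exact: derivedJ (derivedV dx).
Qed.

Lemma abel_mulE x y : abel_mul (\pi_abelianisation x) (\pi y) = \pi_abelianisation (x * y).
Proof.
have /abel_piP dx : \pi_abelianisation (repr (\pi_abelianisation x)) = \pi_abelianisation x.
  by rewrite reprK.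
have /abel_piP dy : \pi_abelianisation (repr (\pi_abelianisation y)) = \pi y.
  by rewrite reprK.
apply/abel_piP; set x' := repr _ in dx *; set y' := repr _ in dy *.
have -> : (x' * y')^-1 * (x * y) = (x'^-1 * x) ^ y' * (y'^-1 * y).
  by rewrite /conjg invgM !mulgA mulgK.
exact: derivedM (derivedJ _ dx) dy.
Qed.

Fact abel_mulA : associative abel_mul.
Proof.
by elim/quotW=> x; elim/quotW=> y; elim/quotW=> z;
rewrite (abel_mulE y z) (abel_mulE x y) (abel_mulE x) abel_mulE mulgA.
Qed.

Fact abel_mul1 : left_id abel_one abel_mul.
Proof. by elim/quotW=> x; rewrite abel_mulE mul1g. Qed.

Fact abel_mulr1 : right_id abel_one abel_mul.
Proof. by elim/quotW=> x; rewrite abel_mulE mulg1. Qed.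

Fact abel_mulV : left_inverse abel_one abel_inv abel_mul.
Proof. by elim/quotW=> x; rewrite abel_invE abel_mulE mulVg. Qed.

Fact abel_mulrV : right_inverse abel_one abel_inv abel_mul.
Proof. by elim/quotW=> x; rewrite abel_invE abel_mulE mulgV. Qed.

HB.instance Definition _ := isGroup.Build abelianisation
  abel_mulA abel_mul1 abel_mulr1 abel_mulV abel_mulrV.

Definition is_prod_of_commutators (n : nat) (g : G) : Prop :=
  exists s : n.-tuple (G * G), g = \prod_(p <- s) [~ p.1, p.2].

Lemma is_prod_of_commutatorsP g :
  derived g -> exists n, `[< is_prod_of_commutators n g >].
Proof.
have prodV (s : seq (G * G)) : exists t : seq (G * G),
    (\prod_(p <- s) [~ p.1, p.2])^-1 = \prod_(p <- t) [~ p.1, p.2].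
  elim: s => [|p s [t IH]]; first by exists [::]; rewrite !big_nil invg1.
  exists (rcons t (p.2, p.1)).
  by rewrite big_cons invgM IH -cats1 big_cat big_seq1 invgR.
move=> /(_ (fun h => exists s : seq (G * G), h = \prod_(p <- s) [~ p.1, p.2])).
case=> [|s ->]; last by exists (size s); apply/asboolP; exists (in_tuple s).
split; last by move=> _ [p _ <-]; exists [:: p]; rewrite big_seq1.
split=> [|x y [s ->] [t ->]]; first by exists [::]; rewrite big_nil.
by have [t' ->] := prodV t; exists (s ++ t'); rewrite big_cat.
Qed.

(* Total by convention: the value is 0 outside of [G, G]. *)
Definition commutator_length (g : G) : nat :=
  if pselect (derived g) is left dg then ex_minn (is_prod_of_commutatorsP dg)
  else 0.

End CommutatorSubgroup.

Section Norms.
Variables (R : realType) (G : groupType).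
Implicit Types nu : G -> R.

Definition is_norm nu : Prop :=
  [/\ forall g, (0 <= nu g)%R,
      forall g, nu g = nu g^-1,
      forall g h, (nu (g * h)%g <= nu g + nu h)%R
    & forall g, nu g = 0%R <-> g = 1%g].

Definition conjugation_invariant nu : Prop :=
  forall g h, nu (g * h * g^-1) = nu h.

(* The limit exists for every norm, by subadditivity of p |-> nu (g ^+ p). *)
Definition stably_unbounded nu : Prop :=
  exists (g : G) (l : R),
    l != 0%R /\ (fun p : nat => nu (g ^+ p)%g / p%:R)%R @ \oo --> l.

End Norms.

(* The group <X | rel>, as the quotient of the words in the letters x^{+1}
   (x, true) and x^{-1} (x, false) by the congruence generated by rel and by
   the cancellation of inverse letters. *)
Section Presentation.
Variables (X : choiceType) (rel : seq (X * bool) -> seq (X * bool) -> Prop).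
Local Notation word := (seq (X * bool)).

Inductive pres_cong : word -> word -> Prop :=
| PresRefl u : pres_cong u u
| PresSym u v : pres_cong u v -> pres_cong v u
| PresTrans v u w : pres_cong u v -> pres_cong v w -> pres_cong u w
| PresCat u u' v v' :
    pres_cong u u' -> pres_cong v v' -> pres_cong (u ++ v) (u' ++ v')
| PresCancel x b : pres_cong [:: (x, b); (x, ~~ b)] [::]
| PresRel u v : rel u v -> pres_cong u v.

Definition pres_eq : ssrbool.rel word := fun u v => `[< pres_cong u v >].

Fact pres_eq_equiv : equiv_class_of pres_eq.
Proof.
split=> [u|u v|v u w]; first by apply/asboolP; exact: PresRefl.
  by apply/asboolP/asboolP; exact: PresSym.
by move=> /asboolP uv /asboolP vw; apply/asboolP; exact: PresTrans uv vw.
Qed.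

Canonical pres_equiv := EquivRelPack pres_eq_equiv.

Definition presented := {eq_quot pres_eq}.

HB.instance Definition _ := Choice.on presented.
HB.instance Definition _ := Quotient.on presented.

Lemma pres_piP (u v : word) : \pi_presented u = \pi_presented v <-> pres_cong u v.
Proof.
split; first by move/(@eqquotP _ pres_equiv presented)/asboolP.
by move=> uv; apply/(@eqquotP _ pres_equiv presented)/asboolP.
Qed.

Lemma pres_repr u : pres_cong (repr (\pi_presented u)) u.
Proof. by apply/pres_piP; rewrite reprK. Qed.

Definition wordV (u : word) : word := rev [seq (l.1, ~~ l.2) | l <- u].

Lemma wordV_cons l u : wordV (l :: u) = wordV u ++ [:: (l.1, ~~ l.2)].
Proof. by rewrite /wordV /= rev_cons cats1. Qed.

Lemma wordVK : involutive wordV.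
Proof.
move=> u; rewrite /wordV map_rev revK -map_comp -[RHS]map_id.
by apply: eq_map => -[x b] /=; rewrite negbK.
Qed.

Lemma pres_mulV u : pres_cong (u ++ wordV u) [::].
Proof.
elim: u => [|[x b] u IH]; first exact: PresRefl.
have -> : ((x, b) :: u) ++ wordV ((x, b) :: u) =
    [:: (x, b)] ++ ((u ++ wordV u) ++ [:: (x, ~~ b)]).
  by rewrite wordV_cons -catA.
apply: (@PresTrans ([:: (x, b)] ++ ([::] ++ [:: (x, ~~ b)]))).
  by apply: PresCat (PresRefl _) _; apply: PresCat IH (PresRefl _).
exact: PresCancel.
Qed.

Lemma pres_Vmul u : pres_cong (wordV u ++ u) [::].
Proof. by rewrite -{2}(wordVK u); exact: pres_mulV. Qed.

Lemma pres_congV u v : pres_cong u v -> pres_cong (wordV u) (wordV v).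
Proof.
move=> uv; apply: (@PresTrans (wordV u ++ (v ++ wordV v))).
  rewrite -[X in pres_cong X _]cats0; apply: PresCat; first exact: PresRefl.
  exact/PresSym/pres_mulV.
rewrite catA -[X in pres_cong _ X]cat0s; apply: PresCat; last exact: PresRefl.
apply: PresTrans (pres_Vmul u); apply: PresCat; first exact: PresRefl.
exact: PresSym.
Qed.

Definition pres_one : presented := \pi_presented [::].
Definition pres_inv (a : presented) : presented := \pi_presented (wordV (repr a)).
Definition pres_mul (a b : presented) : presented := \pi_presented (repr a ++ repr b).

Lemma pres_invE u : pres_inv (\pi_presented u) = \pi_presented (wordV u).
Proof. exact/pres_piP/pres_congV/pres_repr. Qed.

Lemma pres_mulE u v : pres_mul (\pi_presented u) (\pi v) = \pi_presented (u ++ v).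
Proof. by apply/pres_piP/PresCat; exact: pres_repr. Qed.

Fact pres_mulA : associative pres_mul.
Proof.
by elim/quotW=> u; elim/quotW=> v; elim/quotW=> w;
rewrite (pres_mulE v w) (pres_mulE u v) (pres_mulE u) pres_mulE catA.
Qed.

Fact pres_mul1 : left_id pres_one pres_mul.
Proof. by elim/quotW=> u; rewrite pres_mulE. Qed.

Fact pres_mulr1 : right_id pres_one pres_mul.
Proof. by elim/quotW=> u; rewrite pres_mulE cats0. Qed.

Fact pres_mulVl : left_inverse pres_one pres_inv pres_mul.
Proof.
by elim/quotW=> u; rewrite pres_invE pres_mulE; exact/pres_piP/pres_Vmul.
Qed.

Fact pres_mulVr : right_inverse pres_one pres_inv pres_mul.
Proof.
by elim/quotW=> u; rewrite pres_invE pres_mulE; exact/pres_piP/pres_mulV.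
Qed.

HB.instance Definition _ := isGroup.Build presented
  pres_mulA pres_mul1 pres_mulr1 pres_mulVl pres_mulVr.

End Presentation.

(* Artin's presentation of the braid group on n strings: the generator
   i : 'I_n.-1 exchanges the strings i and i.+1 (strings numbered from 0). *)
Inductive artin_rel (n : nat) :
    seq ('I_n.-1 * bool) -> seq ('I_n.-1 * bool) -> Prop :=
| ArtinFar (i j : 'I_n.-1) : (i.+1 < j)%N ->
    artin_rel [:: (i, true); (j, true)] [:: (j, true); (i, true)]
| ArtinBraid (i j : 'I_n.-1) : j = i.+1 :> nat ->
    artin_rel [:: (i, true); (j, true); (i, true)]
              [:: (j, true); (i, true); (j, true)].

Definition braid (n : nat) := presented (@artin_rel n).

HB.instance Definition _ n := Group.on (braid n).
HB.instance Definition _ n := Quotient.on (braid n).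

Lemma braid_piM n (u v : seq ('I_n.-1 * bool)) :
  \pi_(braid n) u * \pi_(braid n) v = \pi_(braid n) (u ++ v).
Proof. exact: pres_mulE. Qed.

Section Inclusion.
Variables (m n : nat) (lemn : (m <= n)%N).

Fact leq_pred_mono : (m.-1 <= n.-1)%N.
Proof. by rewrite -!subn1 leq_sub2r. Qed.

Definition incl_letter (l : 'I_m.-1 * bool) : 'I_n.-1 * bool :=
  (widen_ord leq_pred_mono l.1, l.2).

(* The inclusion B_m -> B_n onto the first m strings. *)
Definition incl (a : braid m) : braid n :=
  \pi_(braid n) (map incl_letter (repr a)).

Lemma incl_cong u v : pres_cong (@artin_rel m) u v ->
  pres_cong (@artin_rel n) (map incl_letter u) (map incl_letter v).
Proof.
elim=> {u v}.
- by move=> u; exact: PresRefl.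
- by move=> u v _; exact: PresSym.
- by move=> v u w _ uv _ vw; exact: PresTrans uv vw.
- by move=> u u' v v' _ uu _ vv; rewrite !map_cat; exact: PresCat.
- by move=> x b; exact: PresCancel.
by move=> u v []i j ij; apply: PresRel; constructor.
Qed.

Lemma inclE u : incl (\pi_(braid m) u) = \pi_(braid n) (map incl_letter u).
Proof. exact/pres_piP/incl_cong/pres_repr. Qed.

Lemma inclM : {morph incl : a b / a * b}.
Proof.
elim/quotW=> u; elim/quotW=> v.
by rewrite braid_piM !inclE braid_piM map_cat.
Qed.

Lemma inclF : {morph incl : a b / a / b}.
Proof. by move=> a b; apply/(mulIg (incl b)); rewrite -inclM !mulgVK. Qed.

HB.instance Definition _ := isGroupMorphism.Build (braid m) (braid n) incl inclF.

Lemma incl1 : incl 1 = 1.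
Proof. exact: gmulf1. Qed.

Lemma inclV : {morph incl : a / a^-1}.
Proof. exact: gmulfV. Qed.

End Inclusion.

Lemma incl_id n (le_nn : (n <= n)%N) (a : braid n) : incl le_nn a = a.
Proof.
elim/quotW: a => u; rewrite inclE; congr (\pi_(braid n) _).
by rewrite -[RHS]map_id; apply: eq_map => -[i b]; congr pair; exact: val_inj.
Qed.

Lemma incl_comp m n p (mn : (m <= n)%N) (np : (n <= p)%N) (mp : (m <= p)%N) a :
  incl np (incl mn a) = incl mp a.
Proof.
elim/quotW: a => u; rewrite (inclE mn) (inclE mp) (inclE np) -map_comp; congr (\pi_(braid p) _).
by apply: eq_map => -[i b]; congr pair; exact: val_inj.
Qed.

(* The union of the B_n along the inclusions, i.e. their direct limit: pairs
   (n, a) with a in B_n, two pairs being equal if they agree in some B_k. *)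
Section InfiniteBraidGroup.
Local Notation prebraid := {n : nat & braid n}.

Definition braid_inf_eq : rel prebraid := fun a b =>
  `[< exists k (ak : (tag a <= k)%N) (bk : (tag b <= k)%N),
        incl ak (tagged a) = incl bk (tagged b) >].

Fact braid_inf_eq_equiv : equiv_class_of braid_inf_eq.
Proof.
split=> [a|a b|b a c].
- by apply/asboolP; exists (tag a), (leqnn _), (leqnn _).
- by apply/asboolP/asboolP => -[k [ak [bk e]]]; exists k, bk, ak.
move=> /asboolP[k [ak [bk e]]] /asboolP[l [bl [cl f]]]; apply/asboolP.
have kkl := leq_maxl k l; have lkl := leq_maxr k l.
exists (maxn k l), (leq_trans ak kkl), (leq_trans cl lkl).
rewrite -(incl_comp ak kkl) e -(incl_comp cl lkl) -f.
by rewrite !(incl_comp _ _ (leq_trans bk kkl)).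
Qed.

Canonical braid_inf_equiv := EquivRelPack braid_inf_eq_equiv.

Definition braid_inf := {eq_quot braid_inf_eq}.

HB.instance Definition _ := Choice.on braid_inf.
HB.instance Definition _ := Quotient.on braid_inf.

Definition to_braid_inf n (a : braid n) : braid_inf :=
  \pi_braid_inf (Tagged braid a).

Lemma to_braid_infP m n (a : braid m) (b : braid n) :
  to_braid_inf a = to_braid_inf b <->
  exists k (mk : (m <= k)%N) (nk : (n <= k)%N), incl mk a = incl nk b.
Proof.
split; first by move/(@eqquotP _ braid_inf_equiv braid_inf)/asboolP.
by move=> e; apply/(@eqquotP _ braid_inf_equiv braid_inf)/asboolP.
Qed.

Lemma to_braid_inf_incl m n (mn : (m <= n)%N) (a : braid m) :
  to_braid_inf (incl mn a) = to_braid_inf a.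
Proof.
by apply/to_braid_infP; exists n, (leqnn n), mn; rewrite (incl_comp _ _ mn).
Qed.

Lemma to_braid_inf_repr (x : braid_inf) : to_braid_inf (tagged (repr x)) = x.
Proof. by rewrite /to_braid_inf /Tagged -[RHS]reprK; case: (repr x). Qed.

Lemma to_braid_infW N (x : braid_inf) :
  exists2 n, (N <= n)%N & exists a : braid n, x = to_braid_inf a.
Proof.
exists (maxn N (tag (repr x))); first exact: leq_maxl.
exists (incl (leq_maxr _ _) (tagged (repr x))).
by rewrite to_braid_inf_incl to_braid_inf_repr.
Qed.

Definition braid_inf_one : braid_inf := to_braid_inf (1 : braid 0).

Definition braid_inf_inv (x : braid_inf) : braid_inf :=
  to_braid_inf (tagged (repr x))^-1.

Definition braid_inf_mul (x y : braid_inf) : braid_inf :=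
  to_braid_inf (incl (leq_maxl _ _) (tagged (repr x)) *
                incl (leq_maxr _ _) (tagged (repr y))).

Lemma braid_inf_oneE n : to_braid_inf (1 : braid n) = braid_inf_one.
Proof.
by apply/to_braid_infP; exists n, (leqnn n), (leq0n n); rewrite !incl1.
Qed.

Lemma braid_inf_invE n (a : braid n) :
  braid_inf_inv (to_braid_inf a) = to_braid_inf a^-1.
Proof.
have /to_braid_infP[k [mk [nk e]]] := to_braid_inf_repr (to_braid_inf a).
by apply/to_braid_infP; exists k, mk, nk; rewrite !inclV e.
Qed.

Lemma braid_inf_mulE n (a b : braid n) :
  braid_inf_mul (to_braid_inf a) (to_braid_inf b) = to_braid_inf (a * b).
Proof.
have := to_braid_inf_repr (to_braid_inf a).
have := to_braid_inf_repr (to_braid_inf b).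
rewrite /braid_inf_mul.
set x := tagged (repr (to_braid_inf a)); set y := tagged (repr (to_braid_inf b)).
move=> /to_braid_infP[l [yl [nl f]]] /to_braid_infP[k [xk [nk e]]].
set xm := leq_maxl _ _; set ym := leq_maxr _ _; set M := maxn _ _ in xm ym *.
pose K := maxn M (maxn k l).
have MK : (M <= K)%N by exact: leq_maxl.
have kK : (k <= K)%N by rewrite /K !leq_max leqnn orbT.
have lK : (l <= K)%N by rewrite /K !leq_max leqnn !orbT.
have nK := leq_trans nk kK.
apply/to_braid_infP; exists K, MK, nK; rewrite !inclM.
rewrite (incl_comp _ _ (leq_trans xk kK)) (incl_comp _ _ (leq_trans yl lK)).
rewrite -(incl_comp xk kK) e -(incl_comp yl lK) f.
by rewrite !(incl_comp _ _ nK).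
Qed.

Lemma to_braid_inf3W (x y z : braid_inf) : exists n (a b c : braid n),
  [/\ x = to_braid_inf a, y = to_braid_inf b & z = to_braid_inf c].
Proof.
have [m _ [a ->]] := to_braid_infW 0 x.
have [n mn [b ->]] := to_braid_infW m y.
have [p np [c ->]] := to_braid_infW n z.
exists p, (incl (leq_trans mn np) a), (incl np b), c.
by rewrite !to_braid_inf_incl.
Qed.

Fact braid_inf_mulA : associative braid_inf_mul.
Proof.
move=> x y z; have [n [a [b [c [-> -> ->]]]]] := to_braid_inf3W x y z.
by rewrite (braid_inf_mulE b c) (braid_inf_mulE a b) !braid_inf_mulE mulgA.
Qed.

Fact braid_inf_mul1 : left_id braid_inf_one braid_inf_mul.
Proof.
move=> x; have [n _ [a ->]] := to_braid_infW 0 x.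
by rewrite -(braid_inf_oneE n) braid_inf_mulE mul1g.
Qed.

Fact braid_inf_mulr1 : right_id braid_inf_one braid_inf_mul.
Proof.
move=> x; have [n _ [a ->]] := to_braid_infW 0 x.
by rewrite -(braid_inf_oneE n) braid_inf_mulE mulg1.
Qed.

Fact braid_inf_mulVl : left_inverse braid_inf_one braid_inf_inv braid_inf_mul.
Proof.
move=> x; have [n _ [a ->]] := to_braid_infW 0 x.
by rewrite braid_inf_invE braid_inf_mulE mulVg braid_inf_oneE.
Qed.

Fact braid_inf_mulVr : right_inverse braid_inf_one braid_inf_inv braid_inf_mul.
Proof.
move=> x; have [n _ [a ->]] := to_braid_infW 0 x.
by rewrite braid_inf_invE braid_inf_mulE mulgV braid_inf_oneE.
Qed.

HB.instance Definition _ := isGroup.Build braid_inf braid_inf_mulA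
  braid_inf_mul1 braid_inf_mulr1 braid_inf_mulVl braid_inf_mulVr.

End InfiniteBraidGroup.

(* Main.v *)
Require Import Defs.
From mathcomp Require Import all_boot all_order all_algebra.
From mathcomp Require Import all_classical all_reals all_analysis.
From mathcomp Require Import ring lra zify.
Import numFieldNormedType.Exports.

(** Write s_i for the generators of the infinite braid group B and G for [B, B].

  G is perfect.  Let c be a generator commuting with s_i and s_(i+1).  Then
  x = s_i c^-1 and y = s_(i+1) c^-1 lie in G and still satisfy x y x = y x y, so
  that y x^-1 = [x, y] lies in [G, G].  Modulo [G, G], which is normal in B, all
  the generators agree; hence B/[G, G] is cyclic and [B, B] is contained in
  [G, G] ([derived_braid_inf_perfect]).

  Commutator length is stably trivial because every finite set of braids can be
  displaced: conjugation by s_0 ... s_(N-1) shifts the generators, so for all n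
  and k some t in G moves B_n to copies B_n^t, ..., B_n^(t^k) that commute with
  B_n and with each other ([displacement]).  If h is a product of m commutators
  in B_n, then so is the diagonal element h h^t ... h^(t^(k-1)), and a
  telescoping argument shows that it differs from h^k, up to conjugation, by a
  single commutator.  Thus the commutator length of h^k is at most m + 1 for
  every k ([power_of_commutators]).

  The norm is the least number of conjugates of the s_i^{+1} and s_i^{-1} whose
  product is a given braid.  It grows linearly on some element for the same
  reason that signatures of closed braids do.  A word w of length l has a
  quadratic form Q_w in l variables ([form]), essentially the symmetrised
  Seifert form of the closure, in which the number of strings does not occur.
  Braid relations and rotations of w change Q_w by a linear substitution, and a
  cancelling pair of letters adds a hyperbolic plane.  The number of negative
  letters minus the positive index of Q_w, the deficit of w, is therefore a
  conjugation invariant of the braid ([deficit_cong], [deficit_rot]), and one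
  more letter raises it by at most one.  So the deficit bounds the norm from
  below ([prod_of_deficit]).  Finally there is g in G, with 8 positive and 8
  negative letters, such that the form of each copy of g in g^p has a null
  vector supported on the positive letters and orthogonal to the other copies.
  The positive index is then at most 7p, and the deficit of g^p at least p
  ([deficit_test_word]).  The limit of nu(g^p)/p exists by Fekete's lemma
  ([fekete]), and it is at least 1. *)

Set Implicit Arguments.
Unset Strict Implicit.
Unset Printing Implicit Defensive.

Import Order.TTheory GRing.Theory Num.Theory.

Local Open Scope classical_set_scope.
Local Open Scope ring_scope.

Local Notation letter := (nat * bool)%type.

(** * Subadditive and bounded sequences *)

(** Dividing n by a fixed m gives u n <= (n / m) u m + C, with C independent
  of n; so u n / n is eventually below u m / m + e, for every m, while it is
  never below the infimum of these quotients. *)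
Lemma fekete (R : realType) (u : nat -> R) :
    (forall n, 0 <= u n) -> (forall m n, u (m + n)%N <= u m + u n) ->
  exists l : R, (fun n => u n / n%:R) @ \oo --> l.
Proof.
move=> u0 uD; pose A := [set u n.+1 / n.+1%:R | n in [set: nat]].
have lbA : lbound A 0 by move=> _ [n _ <-]; rewrite divr_ge0.
have hA : has_inf A by split; [exists (u 1%N / 1%:R), 0%N | exists 0].
exists (inf A); apply/cvgrPdist_le => e e0.
have e2 : 0 < e / 2 by lra.
have [_ [m _ <-] mlt] := inf_adherent e2 hA.
have uq q r : u (q * m.+1 + r)%N <= q%:R * u m.+1 + u r.
  elim: q => [|q IH]; first by rewrite mul0r add0r.
  rewrite mulSn -addnA (le_trans (uD _ _)) // -natr1.
  by rewrite mulrDl mul1r [leRHS]addrAC [leRHS]addrC lerD2l.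
pose C := \sum_(i < m.+1) u i.
have uC r : (r < m.+1)%N -> u r <= C.
  move=> rm; rewrite /C (bigD1 (Ordinal rm)) //= lerDl.
  exact: sumr_ge0.
near=> n.
have n0 : 0 < n%:R :> R by rewrite ltr0n; near: n; exists 1%N.
have Cn : C / n%:R <= e / 2.
  rewrite ler_pdivrMr // mulrC -ler_pdivrMr //.
  by near: n; exact: nbhs_infty_ger.
have ge_inf : inf A <= u n / n%:R.
  apply: ge_inf; first by exists 0.
  by exists n.-1 => //; rewrite prednK // -(ltr0n R).
rewrite ler0_norm ?subr_le0 // opprB lerBlDl.
apply: le_trans (_ : u m.+1 / m.+1%:R + C / n%:R <= _); last first.
  by rewrite [e in leRHS]splitr addrA lerD // ltW.
rewrite -ler_pdivlMr ?invr_gt0 // invrK mulrDl divfK ?gt_eqF //.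
rewrite {1}(divn_eq n m.+1) (le_trans (uq _ _)) // lerD ?uC ?ltn_mod //.
rewrite mulrAC -mulrA [leLHS]mulrC ler_wpM2l // ler_pdivlMr ?ltr0n //.
by rewrite -natrM ler_nat leq_trunc_div.
Unshelve. all: by end_near. Qed.

Lemma bounded_div_cvg0 (R : realType) (u : nat -> nat) m :
  (forall k, u k <= m)%N -> (fun k => (u k)%:R / k%:R : R) @ \oo --> 0.
Proof.
move=> um; apply/cvgrPdist_le => e e0; near=> k.
have k0 : 0 < k%:R :> R by rewrite ltr0n; near: k; exists 1%N.
rewrite sub0r normrN ger0_norm ?divr_ge0 // ler_pdivrMr //.
apply: (@le_trans _ _ m%:R); first by rewrite ler_nat.
rewrite mulrC -ler_pdivrMr //; near: k; exact: nbhs_infty_ger.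
Unshelve. all: by end_near. Qed.

(** * Word length with respect to a conjugation-invariant set *)

Section ConjugateWords.

Local Open Scope group_scope.

Variables (G : groupType) (T : set G).

Inductive prod_of : nat -> G -> Prop :=
| ProdOf0 : prod_of 0 1
| ProdOfS n x t : prod_of n x -> T t -> prod_of n.+1 (x * t).

Lemma prod_ofM m n x y : prod_of m x -> prod_of n y -> prod_of (m + n) (x * y).
Proof.
move=> mx; elim=> [|k z t _ IH Tt]; first by rewrite addn0 mulg1.
by rewrite addnS mulgA; exact: ProdOfS.
Qed.

Lemma prod_of1 t : T t -> prod_of 1 t.
Proof. by rewrite -{2}(mul1g t); exact/ProdOfS/ProdOf0. Qed.

Hypothesis TV : forall t, T t -> T t^-1.
Hypothesis TJ : forall t y, T t -> T (t ^ y).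

Lemma prod_ofV n x : prod_of n x -> prod_of n x^-1.
Proof.
elim=> [|k z t _ IH Tt]; first by rewrite invg1; exact: ProdOf0.
by rewrite invgM -add1n; apply: prod_ofM => //; exact/prod_of1/TV.
Qed.

Lemma prod_ofJ n x y : prod_of n x -> prod_of n (x ^ y).
Proof.
elim=> [|k z t _ IH Tt]; first by rewrite conj1g; exact: ProdOf0.
by rewrite conjMg; apply: ProdOfS => //; exact: TJ.
Qed.

End ConjugateWords.

(** * Displacement and commutators *)

Section Subgroups.

Local Open Scope group_scope.

Variables (G : groupType) (A : set G).
Hypothesis subA : is_subgroup A.

Lemma is_subgroupV x : A x -> A x^-1.
Proof. by case: subA => A1 AF Ax; rewrite -(mul1g x^-1); exact: AF. Qed.

Lemma is_subgroupM x y : A x -> A y -> A (x * y).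
Proof.
by case: subA => _ AF Ax /is_subgroupV Ay; rewrite -(invgK y); exact: AF.
Qed.

Lemma is_subgroupX x n : A x -> A (x ^+ n).
Proof.
move=> Ax; elim: n => [|n IH]; first by case: subA.
by rewrite expgS; exact: is_subgroupM.
Qed.

End Subgroups.

Section Displacement.

Local Open Scope group_scope.

Variable G : groupType.

Lemma commuteJ (x y z : G) : commute x y -> commute (x ^ z) (y ^ z).
Proof. by rewrite /commute -!conjMg => ->. Qed.

(** The diagonal copy of [h] in the product of the conjugates of a group by
  powers of [t]; when these conjugates commute, it is multiplicative in [h]. *)
Definition spread (t : G) (k : nat) (h : G) := \prod_(0 <= i < k) h ^ (t ^+ i).

Lemma spreadS t k h : spread t k.+1 h = spread t k h * h ^ (t ^+ k).
Proof. exact: big_nat_recr. Qed.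

Lemma spread_recl t k h : spread t k.+1 h = h * spread t k h ^ t.
Proof.
rewrite /spread big_nat_recl // expg0 conjg1 conjg_prod; congr (_ * _).
by apply: eq_bigr => i _; rewrite -conjgM expgSr.
Qed.

Lemma spread1 t k : spread t k 1 = 1.
Proof. by apply: big1 => i _; rewrite conj1g. Qed.

Lemma commute_spread t k h z :
  (forall i, (i < k)%N -> commute z (h ^ (t ^+ i))) -> commute z (spread t k h).
Proof.
elim: k => [|k IH] zh; first by rewrite /spread big_geq //; exact: commute1.
rewrite spreadS; apply: commuteM; last exact: zh.
by apply: IH => i ik; apply: zh; exact: ltnW.
Qed.

Variables (H : set G) (t : G) (k : nat).
Hypothesis subH : is_subgroup H.
Hypothesis disp : forall i x y, (0 < i <= k)%N -> H x -> H y ->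
  commute x (y ^ (t ^+ i)).

Lemma commute_disp i j x y : (i < j <= k)%N -> H x -> H y ->
  commute (x ^ (t ^+ i)) (y ^ (t ^+ j)).
Proof.
move=> /andP[ij jk] Hx Hy; rewrite -(subnK (ltnW ij)) expgnDr conjgM.
by apply: commuteJ; apply: disp => //; lia.
Qed.

Lemma spreadM j : (j <= k.+1)%N -> forall x y, H x -> H y ->
  spread t j (x * y) = spread t j x * spread t j y.
Proof.
elim: j => [|j IH] jk x y Hx Hy; first by rewrite /spread !big_geq // mulg1.
have c : commute (x ^ (t ^+ j)) (spread t j y).
  apply: commute_spread => i ij.
  by apply/commute_sym/commute_disp => //; rewrite ij.
rewrite !spreadS IH // ?(ltnW jk) // conjMg.
move: (spread t j x) (x ^ _) (spread t j y) (y ^ _) c => X a Y b c.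
by rewrite -!mulgA; congr (_ * _); rewrite !mulgA c.
Qed.

Lemma spreadV j x : (j <= k.+1)%N -> H x -> spread t j x^-1 = (spread t j x)^-1.
Proof.
move=> jk Hx; apply/esym/mulg1_eq; rewrite -spreadM ?mulgV ?spread1 //.
exact: is_subgroupV.
Qed.

Lemma spreadR j x y : (j <= k.+1)%N -> H x -> H y ->
  spread t j [~ x, y] = [~ spread t j x, spread t j y].
Proof.
move=> jk Hx Hy; have [HxV HyV] := (is_subgroupV subH Hx, is_subgroupV subH Hy).
have Hxy := is_subgroupM subH Hx Hy; have Hyxy := is_subgroupM subH HyV Hxy.
by rewrite !commgEl !conjgE !spreadM // !spreadV.
Qed.

Lemma spread_prod_commutators (s : seq (G * G)) :
  (forall p, p \in s -> H p.1 /\ H p.2) ->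
  H (\prod_(p <- s) [~ p.1, p.2]) /\
  spread t k (\prod_(p <- s) [~ p.1, p.2]) =
    \prod_(p <- [seq (spread t k p.1, spread t k p.2) | p <- s]) [~ p.1, p.2].
Proof.
elim: s => [|p s IH] Hs; first by rewrite !big_nil spread1; case: subH.
have [|Hp eq_s] := IH; first by move=> q qs; apply: Hs; rewrite inE qs orbT.
have [Hp1 Hp2] := Hs p (mem_head _ _).
have HR : H [~ p.1, p.2].
  have [Hp1V Hp2V] := (is_subgroupV subH Hp1, is_subgroupV subH Hp2).
  exact: is_subgroupM Hp1V (is_subgroupM subH Hp2V (is_subgroupM subH Hp1 Hp2)).
rewrite !big_cons; split; first exact: is_subgroupM.
by rewrite spreadM // eq_s spreadR.
Qed.

(** In terms of the commuting elements h_i = h^(t^i), take x to be the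
  product of the h_i^(j-i) over i < j. Then x^t has each exponent shifted by
  one place, and x divided by x^t is h_0^j divided by h_1 ... h_j. *)
Lemma spread_telescope h j : H h -> (j <= k)%N ->
  exists x, [/\ h ^+ j * x ^ t = spread t j h ^ t * x
    & forall z, (forall i, (i < j)%N -> commute z (h ^ (t ^+ i))) ->
        commute z x].
Proof.
move=> Hh; have hh i l : (i <= k)%N -> (l <= k)%N ->
    commute (h ^ (t ^+ i)) (h ^ (t ^+ l)).
  move=> ik lk; case: (ltngtP i l) => [il|li|->]; last exact: commute_refl.
    by apply: commute_disp => //; rewrite il.
  by apply/commute_sym/commute_disp => //; rewrite li.
elim: j => [|j IH] jk.
  exists 1; split; last by move=> z _; exact: commute1.
  by rewrite /spread big_geq // !conj1g expg0.
have [x [ex cx]] := IH (ltnW jk).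
exists (x * spread t j.+1 h); split; last first.
  move=> z zh; apply: commuteM; last exact: commute_spread.
  by apply: cx => i ij; apply: zh; exact: ltnW.
have hD i l : (i <= k)%N -> (l <= k.+1)%N ->
    commute (h ^ (t ^+ i)) (spread t l h).
  by move=> ik lk; apply: commute_spread => i' i'l; apply: hh; lia.
set D := spread t j.+1 h.
have DtE : D ^ t = h^-1 * spread t j.+2 h by rewrite spread_recl mulKg.
have hDt i : (i <= k)%N -> commute (h ^ (t ^+ i)) (D ^ t).
  move=> ik; rewrite DtE; apply: commuteM; last exact: hD.
  by apply: commuteV; have := hh i 0%N ik (leq0n k); rewrite expg0 conjg1.
have xDt : commute (D ^ t) x by apply: cx => i ij; apply/commute_sym/hDt; lia.
have xD : commute D x by apply: cx => i ij; apply/commute_sym/hD; lia.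
have DDt : commute (D ^ t) D.
  by apply: commute_spread => i ij; apply/commute_sym/hDt; lia.
have : D = h * spread t j h ^ t := spread_recl t j h.
rewrite conjMg expgS.
move: (h ^+ j) (x ^ t) (D ^ t) (spread t j h ^ t) ex xDt DDt.
move=> hj xt Dt Djt ex xDt DDt eD.
rewrite -mulgA (mulgA hj) ex -(mulgA Djt) (mulgA h) -eD -xDt mulgA -DDt -mulgA.
by rewrite xD.
Qed.

(** By [spread_telescope], h^k is a conjugate of the diagonal copy of [h],
  again a product of [size s] commutators, times one commutator with [t]. *)
Lemma power_of_commutators (s : seq (G * G)) :
  (forall p, p \in s -> H p.1 /\ H p.2) ->
  is_prod_of_commutators (size s).+1 ((\prod_(p <- s) [~ p.1, p.2]) ^+ k).
Proof.
move=> /spread_prod_commutators[]; set h := \prod_(p <- s) _ => Hh eh.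
have [x [ex _]] := spread_telescope Hh (leqnn k).
have -> : h ^+ k = spread t k h ^ t * [~ x^-1, t].
  by rewrite commgEl invgK conjVg mulgA -ex mulgK.
pose s' := [seq ((spread t k p.1) ^ t, (spread t k p.2) ^ t) | p <- s].
have sz : size (rcons s' (x^-1, t)) == (size s).+1.
  by rewrite size_rcons size_map.
exists (Tuple sz); rewrite /= -cats1 big_cat big_seq1 /= eh conjg_prod.
congr (_ * _); rewrite !big_map; apply: eq_bigr => p _; exact: conjRg.
Qed.

End Displacement.

(** * Words in the generators of the infinite braid group *)

(** The Artin relations on infinitely many strings. The words of all braid
  groups become words over one alphabet, which makes the inclusions
  invisible. *)
Inductive artin_nat : seq (nat * bool) -> seq (nat * bool) -> Prop :=
| ArtinNatFar i j : (i.+1 < j)%N ->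
    artin_nat [:: (i, true); (j, true)] [:: (j, true); (i, true)]
| ArtinNatBraid i :
    artin_nat [:: (i, true); (i.+1, true); (i, true)]
              [:: (i.+1, true); (i, true); (i.+1, true)].

Section Words.

Local Open Scope quotient_scope.
Local Open Scope group_scope.

Definition gen (i : nat) : braid_inf :=
  to_braid_inf (\pi_(braid i.+2) [:: (ord_max : 'I_i.+1, true)]).

Definition letter_ev (l : letter) : braid_inf :=
  if l.2 then gen l.1 else (gen l.1)^-1.

Definition ev (w : seq letter) : braid_inf := \prod_(l <- w) letter_ev l.

Lemma ev_nil : ev [::] = 1.
Proof. exact: big_nil. Qed.

Lemma ev_cons l w : ev (l :: w) = letter_ev l * ev w.
Proof. exact: big_cons. Qed.

Lemma ev_cat u v : ev (u ++ v) = ev u * ev v.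
Proof. exact: big_cat. Qed.

Lemma letter_evV (l : letter) : letter_ev (l.1, ~~ l.2) = (letter_ev l)^-1.
Proof. by case: l => i []; rewrite /letter_ev /= ?invgK. Qed.

Lemma ev_wordV w : ev (wordV w) = (ev w)^-1.
Proof.
elim: w => [|l w IH]; first by rewrite ev_nil invg1 -ev_nil.
by rewrite wordV_cons ev_cat IH !ev_cons ev_nil mulg1 letter_evV invgM.
Qed.

Definition nat_letter n (l : 'I_n * bool) : letter := (val l.1, l.2).

Lemma to_braid_infM n (a b : braid n) :
  to_braid_inf (a * b) = to_braid_inf a * to_braid_inf b.
Proof. by rewrite -braid_inf_mulE. Qed.

Lemma to_braid_infV n (a : braid n) : to_braid_inf a^-1 = (to_braid_inf a)^-1.
Proof. by rewrite -braid_inf_invE. Qed.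

Lemma to_braid_inf_letter n (l : 'I_n.-1 * bool) :
  to_braid_inf (\pi_(braid n) [:: l]) = letter_ev (nat_letter l).
Proof.
case: l => i b.
have in2 : (i.+2 <= n)%N by move: (ltn_ord i); lia.
have genE : to_braid_inf (\pi_(braid n) [:: (i, true)]) = gen i.
  rewrite /gen -(to_braid_inf_incl in2) inclE.
  congr (to_braid_inf (\pi_(braid n) [:: (_, _)])).
  exact: val_inj.
case: b => //; rewrite /letter_ev /= -genE -to_braid_infV.
by congr to_braid_inf; apply: esym; apply: pres_invE.
Qed.

Lemma to_braid_infE n (u : seq ('I_n.-1 * bool)) :
  to_braid_inf (\pi_(braid n) u) = ev (map (@nat_letter _) u).
Proof.
elim: u => [|l u IH]; first by rewrite ev_nil; exact: braid_inf_oneE.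
by rewrite -cat1s -braid_piM to_braid_infM IH to_braid_inf_letter ev_cons.
Qed.

Lemma ev_surj x : exists w, x = ev w.
Proof.
have [n _ [a ->]] := to_braid_infW 0 x.
by elim/quotW: a => u; exists (map (@nat_letter _) u); rewrite to_braid_infE.
Qed.

Lemma nat_letter_lift n w : all (fun l => l.1 < n.+1)%N w ->
  exists u : seq ('I_n.+1 * bool), w = map (@nat_letter _) u.
Proof.
move=> /allP wn; exists [seq (inord l.1, l.2) | l <- w].
rewrite -map_comp -[LHS]map_id; apply/eq_in_map => -[i b] /wn /= i_n.
by rewrite /nat_letter /= inordK.
Qed.

Lemma nat_letter_cong n u v : pres_cong (@artin_rel n) u v ->
  pres_cong artin_nat (map (@nat_letter _) u) (map (@nat_letter _) v).
Proof.
elim=> {u v}.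
- by move=> u; exact: PresRefl.
- by move=> u v _; exact: PresSym.
- by move=> v u w _ uv _ vw; exact: PresTrans uv vw.
- by move=> u u' v v' _ uu _ vv; rewrite !map_cat; exact: PresCat.
- by move=> x b; exact: PresCancel.
move=> u v [] i j ij; apply: PresRel; first exact: ArtinNatFar.
by rewrite /= /nat_letter /= ij; exact: ArtinNatBraid.
Qed.

Lemma letters_bound (w : seq letter) : exists n, all (fun l => l.1 < n.+1)%N w.
Proof.
exists (\max_(l <- w) l.1); apply/allP => l lw; rewrite ltnS.
exact: (@leq_bigmax_seq _ _ xpredT (fun l : letter => l.1)).
Qed.

(** Equality in the direct limit holds at a finite stage, where it comes
  from the relations of that stage. *)
Lemma ev_cong u v : ev u = ev v -> pres_cong artin_nat u v.
Proof.
have [n] := letters_bound (u ++ v); rewrite all_cat => /andP[].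
move=> /nat_letter_lift[u' ->] /nat_letter_lift[v' ->].
rewrite -!(@to_braid_infE n.+2) => /to_braid_infP[k [nk [nk']]].
rewrite !inclE => /pres_piP/nat_letter_cong; rewrite -!map_comp.
by congr pres_cong; apply: eq_map => l.
Qed.

Lemma gen_far i j : (i.+1 < j)%N -> commute (gen i) (gen j).
Proof.
move=> ij.
have ji : (i < j.+1)%N by lia.
have e :
    to_braid_inf (\pi_(braid j.+2) [:: (Ordinal ji, true); (ord_max, true)])
  = to_braid_inf (\pi_(braid j.+2) [:: (ord_max, true); (Ordinal ji, true)]).
  congr to_braid_inf; apply/pres_piP; apply: PresRel; exact: ArtinFar.
by move: e; rewrite !to_braid_infE !ev_cons ev_nil !mulg1.
Qed.

Lemma gen_braid i : gen i * gen i.+1 * gen i = gen i.+1 * gen i * gen i.+1.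
Proof.
pose a : 'I_i.+2 := inord i; pose b : 'I_i.+2 := ord_max.
have av : a = i :> nat by rewrite inordK.
have e : to_braid_inf (\pi_(braid i.+3) [:: (a, true); (b, true); (a, true)])
  = to_braid_inf (\pi_(braid i.+3) [:: (b, true); (a, true); (b, true)]).
  congr to_braid_inf; apply/pres_piP; apply: PresRel; apply: ArtinBraid.
  by rewrite av.
move: e; rewrite !to_braid_infE !ev_cons ev_nil !mulg1 !mulgA.
by rewrite /nat_letter /letter_ev /= av.
Qed.

Lemma gen_commute i j : (i.+1 < j)%N || (j.+1 < i)%N -> commute (gen i) (gen j).
Proof. by case/orP=> [|/gen_far/commute_sym//]; exact: gen_far. Qed.

End Words.

(** * Shifts and displacement of braids *)

Section Shifts.

Local Open Scope group_scope.

Definition between (m n : nat) : set braid_inf :=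
  [set x | exists2 w, all (fun l => m <= l.1 < n)%N w & x = ev w].

Lemma between_subgroup m n : is_subgroup (between m n).
Proof.
split=> [|_ _ [u um ->] [v vm ->]]; first by exists [::] => //; rewrite ev_nil.
exists (u ++ wordV v); last by rewrite ev_cat ev_wordV.
by rewrite all_cat um /wordV all_rev all_map.
Qed.

Lemma between_gen i m n : (m <= i < n)%N -> between m n (gen i).
Proof.
by move=> i_mn; exists [:: (i, true)]; rewrite ?ev_cons ?ev_nil ?mulg1 //= i_mn.
Qed.

Lemma between_sub m n m' n' x : (m' <= m)%N -> (n <= n')%N ->
  between m n x -> between m' n' x.
Proof.
move=> mm nn [w wmn ->]; exists w => //; apply: sub_all wmn => l.
by move=> /andP[ml ln]; rewrite (leq_trans mm ml) (leq_trans ln nn).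
Qed.

Lemma commute_ev x w :
  (forall l, l \in w -> commute x (gen l.1)) -> commute x (ev w).
Proof.
elim: w => [|l w IH] xw; first by rewrite ev_nil; exact: commute1.
rewrite ev_cons; apply: commuteM; last first.
  by apply: IH => l' lw; apply: xw; rewrite inE lw orbT.
rewrite /letter_ev; have := xw l (mem_head _ _); case: l.2 => // c.
exact: commuteV.
Qed.

Lemma between_commute m n m' n' x y : (n < m')%N ->
  between m n x -> between m' n' y -> commute x y.
Proof.
move=> nm [u /allP umn ->] [v /allP vmn ->].
apply: commute_ev => l /vmn /andP[ml _].
apply/commute_sym/commute_ev => l' /umn /andP[_ l'n].
by apply/gen_commute/orP; right; exact: leq_trans (leq_ltn_trans l'n nm) ml.
Qed.

Definition delta N : braid_inf := ev [seq (i, true) | i <- iota 0 N].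

Lemma deltaS N : delta N.+1 = delta N * gen N.
Proof. by rewrite /delta -addn1 iotaD map_cat ev_cat ev_cons ev_nil mulg1. Qed.

Lemma delta_between N : between 0 N (delta N).
Proof.
exists [seq (i, true) | i <- iota 0 N] => //.
by apply/allP => _ /mapP[i iN ->] /=; move: iN; rewrite mem_iota.
Qed.

(** The braid s_0 ... s_(N-1) carries one string across all the others, so
  that conjugation by it renumbers the generators. *)
Lemma delta_gen N i : (i.+1 < N)%N -> delta N * gen i = gen i.+1 * delta N.
Proof.
elim: N => // N IH; rewrite deltaS ltnS leq_eqVlt => /orP[/eqP <-|iN].
  have c : commute (delta i) (gen i.+1).
    have gi : between i.+1 i.+2 (gen i.+1).
      by apply: between_gen; rewrite leqnn ltnSn.
    exact: between_commute (ltnSn i) (delta_between i) gi.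
  rewrite deltaS -!mulgA (mulgA (gen i)) gen_braid !mulgA c.
  by rewrite -!mulgA.
by rewrite -mulgA -(gen_far iN) mulgA IH // -mulgA.
Qed.

Lemma gen_shift N d i : (i + d < N)%N -> gen i ^ (delta N ^- d) = gen (i + d).
Proof.
elim: d => [|d IH] idN; first by rewrite addn0 expg0 invg1 conjg1.
have -> : delta N ^- d.+1 = delta N ^- d * (delta N)^-1 by rewrite -invgM expgS.
rewrite conjgM IH; last by lia.
by rewrite conjgE invgK mulgA delta_gen ?mulgK ?addnS // -addnS.
Qed.

Lemma ev_shift N d w : all (fun l => l.1 + d < N)%N w ->
  ev w ^ (delta N ^- d) = ev [seq (l.1 + d, l.2)%N | l <- w].
Proof.
elim: w => [|l w IH] /=; first by rewrite ev_nil conj1g.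
move=> /andP[lN /IH eqw]; rewrite !ev_cons conjMg eqw; congr (_ * _).
by rewrite /letter_ev /=; case: l.2; rewrite ?conjVg gen_shift.
Qed.

Lemma between_shift N d m n x : (n + d <= N)%N ->
  between m n x -> between (m + d) (n + d) (x ^ (delta N ^- d)).
Proof.
move=> nd [w /allP wmn ->]; exists [seq (l.1 + d, l.2)%N | l <- w].
  by rewrite all_map; apply/allP => l /wmn /=; rewrite leq_add2r ltn_add2r.
by apply: ev_shift; apply/allP => l /wmn; lia.
Qed.

(** A power t0 of [delta N] moves the first [n] generators off
  themselves [k] times. Dividing it by a copy z of t0 that is supported
  beyond all the braids in question turns it into a commutator without
  changing its action on them. *)
Lemma displacement n k : exists2 t, derived t & forall i x y, (0 < i <= k)%N ->
  between 0 n x -> between 0 n y -> commute x (y ^ (t ^+ i)).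
Proof.
(* room for [k] shifts of the first [n] generators by [n.+1] places *)
pose N := (n + k * n.+1)%N; pose t0 := delta N ^- n.+1.
pose s := delta (N + N.+1) ^- N.+1; pose z := t0 ^ s.
have t0N : between 0 N t0.
  have subB := between_subgroup 0 N.
  by have := is_subgroupV subB (is_subgroupX subB n.+1 (delta_between N)).
have zN : between N.+1 (N + N.+1) z.
  by have := @between_shift (N + N.+1) N.+1 0 N t0 (leqnn _) t0N.
have t0z : commute t0 z by exact: between_commute (ltnSn N) t0N zN.
exists (t0 / z).
  have -> : t0 / z = [~ t0^-1, s] by rewrite commgEl invgK conjVg.
  exact: derivedR.
move=> i x y /andP[i0 ik] xn yn.
have yt : between (i * n.+1) (n + i * n.+1) (y ^ (t0 ^+ i)).
  elim: i {i0} ik => [|i IH] ik; first by rewrite !addn0 expg0 conjg1.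
  have Nn : (n + i * n.+1 + n.+1 <= N)%N.
    rewrite -addnA leq_add2l -mulSnr leq_mul2r ik; exact: orbT.
  have := between_shift Nn (IH (ltnW ik)).
  by rewrite -/t0 -conjgM -expgSr -addnA -mulSnr.
have -> : y ^ ((t0 / z) ^+ i) = y ^ (t0 ^+ i).
  rewrite expgnFl // conjgM; apply/conjg_fixP/commgP/commuteV/commuteX.
  apply: between_commute (ltnSn N) (between_sub (leq0n _) _ yt) zN.
  by rewrite leq_add2l leq_mul2r ik orbT.
have ni : (n < i * n.+1)%N by exact: leq_pmull.
exact: between_commute ni xn yt.
Qed.

End Shifts.

(** * Perfectness of the commutator subgroup *)

Section SecondDerived.

Local Open Scope group_scope.

Variable G : groupType.

(** The subgroup [G', G'] of G, where G' = [G, G], inside G rather than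
  inside G', so that conjugation by elements of G makes sense. *)
Definition second_derived : set G :=
  [set x | exists2 g : derived_group G, derived g & val g = x].

Lemma derived_lift (x : G) : derived x -> exists g : derived_group G, val g = x.
Proof. by move=> dx; have /asboolP dx' := dx; exists (DerivedGroup dx'). Qed.

Lemma derived_val_derived (g : derived_group G) : derived (val g).
Proof. by apply/asboolP; exact: (valP g). Qed.

Lemma second_derived_subgroup : is_subgroup second_derived.
Proof.
split=> [|_ _ [g dg <-] [h dh <-]]; first by exists 1; [exact: derived1|].
by exists (g / h); [exact: derivedF|].
Qed.

(** Conjugation by [y] acts on the derived group by an automorphism, which
  preserves its commutators even though [y] is outside. *)
Lemma second_derivedJ x y : second_derived x -> second_derived (x ^ y).
Proof.
case=> g dg <-.
apply: (dg [set g : derived_group G | second_derived (val g ^ y)]).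
split=> [|_ [[a b] _ <-]]; first split=> /=.
- by rewrite conj1g; exists 1; [exact: derived1|].
- move=> a b da db; have [_] := second_derived_subgroup; rewrite conjMg conjVg.
  exact.
have [a' ea] := derived_lift (derivedJ y (derived_val_derived a)).
have [b' eb] := derived_lift (derivedJ y (derived_val_derived b)).
exists [~ a', b']; first exact: derivedR.
transitivity [~ val a', val b']; first by [].
by rewrite ea eb -conjRg.
Qed.

Lemma second_derivedM x y :
  second_derived x -> second_derived y -> second_derived (x * y).
Proof. exact: (@is_subgroupM _ _ second_derived_subgroup). Qed.

Lemma second_derivedV x : second_derived x -> second_derived x^-1.
Proof. exact: (@is_subgroupV _ _ second_derived_subgroup). Qed.

Lemma second_derived_commg_subgroup x :
  is_subgroup [set y | second_derived [~ x, y]].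
Proof.
split=> [|y z /= dy dz].
  by rewrite /= commg1; case: second_derived_subgroup.
have -> : [~ x, y / z] = (([~ x, z])^-1 * [~ x, y]) ^ z^-1.
  by rewrite invgR /commg /conjg invgM !invgK !mulgA mulgV mul1g mulgK.
by apply: second_derivedJ; apply: second_derivedM => //; exact: second_derivedV.
Qed.

(** The braid relation x y x = y x y says exactly that [y / x = [~ x, y]]. *)
Lemma braid_relation_second_derived (x y : G) : derived x -> derived y ->
  x * y * x = y * x * y -> second_derived (y / x).
Proof.
move=> /derived_lift[a ax] /derived_lift[b bx] xy; exists [~ a, b].
  exact: derivedR.
transitivity [~ x, y]; first by rewrite -ax -bx.
apply: (mulIg x); rewrite mulgVK /commg /conjg -!mulgA (mulgA x y) xy.
by rewrite -mulgA !mulKg.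
Qed.

Lemma braid_relation_translate (x y c : G) : commute c x -> commute c y ->
  x * y * x = y * x * y ->
  (x * c) * (y * c) * (x * c) = (y * c) * (x * c) * (y * c).
Proof.
move=> cx cy xyx.
have expand a b : commute c a -> commute c b ->
    (a * c) * (b * c) * (a * c) = a * b * a * (c * c * c).
  move=> ca cb; rewrite -!mulgA; congr (a * _).
  rewrite (mulgA c b) cb -mulgA; congr (b * _).
  by rewrite (mulgA c a) ca -!mulgA (mulgA c a) ca -mulgA.
by rewrite !expand // xyx.
Qed.

End SecondDerived.

Section Perfectness.

Local Open Scope group_scope.

Lemma gen_div_derived i j : derived (gen i / gen j).
Proof.
wlog ij : i j / (i <= j)%N => [wij|].
  case/orP: (leq_total i j) => /wij // d.
  by rewrite -(invgF (gen j)); exact: derivedV.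
pose s := delta j.+1 ^- (j - i).
have -> : gen j = gen i ^ s by rewrite gen_shift subnKC.
by rewrite -conjVg -{1}(invgK (gen i)) -commgEl; exact: derivedR.
Qed.

(** A generator c far from s_k and s_(k+1) turns them into elements of the
  derived group that satisfy the same braid relation. *)
Lemma gen_div_second_derived i j : second_derived (gen i / gen j).
Proof.
have succ k : second_derived (gen k.+1 / gen k).
  pose c := gen k.+3.
  have c0 : commute c^-1 (gen k).
    by apply/commute_sym/commuteV/gen_commute; rewrite ltnS leqnSn.
  have c1 : commute c^-1 (gen k.+1).
    by apply/commute_sym/commuteV/gen_commute; rewrite ltnSn.
  rewrite -(mulgKA c^-1); apply: braid_relation_second_derived.
  - exact: gen_div_derived.
  - exact: gen_div_derived.
  exact: braid_relation_translate (gen_braid k).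
have [D1 DF] := second_derived_subgroup braid_inf.
have from0 k : second_derived (gen k / gen 0%N).
  elim: k => [|k IH]; first by rewrite mulgV.
  by rewrite -(divgKA (gen k)); apply: second_derivedM.
by rewrite -(mulgKA (gen 0%N)^-1); exact: DF.
Qed.

(** Modulo the normal subgroup [second_derived] all generators are equal, so
  the quotient is commutative. *)
Lemma commutators_second_derived (x y : braid_inf) : second_derived [~ x, y].
Proof.
have gen_gen i j : second_derived [~ gen i, gen j].
  rewrite -(mulgVK (gen j) (gen i)); set d := gen i / gen j.
  have -> : [~ d * gen j, gen j] = (d^-1 * d ^ gen j) ^ gen j.
    by rewrite /commg /conjg invgM !mulgA.
  have Dd : second_derived d := gen_div_second_derived i j.
  apply: second_derivedJ; apply: second_derivedM; first exact: second_derivedV.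
  exact: second_derivedJ.
have ev_in (A : set braid_inf) : is_subgroup A -> (forall i, A (gen i)) ->
    forall z, A z.
  move=> subA Agen z; have [w ->] := ev_surj z.
  elim: w => [|l w IH]; first by rewrite ev_nil; case: subA.
  rewrite ev_cons; apply: (is_subgroupM subA) => //.
  by rewrite /letter_ev; case: l.2 => //; exact: (is_subgroupV subA).
have gen_all i z : second_derived [~ gen i, z].
  exact: ev_in (second_derived_commg_subgroup (gen i)) (gen_gen i) z.
rewrite -invgR; apply: second_derivedV.
apply: (ev_in _ (second_derived_commg_subgroup y)) => i.
by rewrite /= -invgR; apply: second_derivedV.
Qed.

Lemma derived_braid_inf_perfect (g : derived_group braid_inf) : derived g.
Proof.
have [g' dg' /val_inj <- //] : second_derived (val g).
apply: (derived_val_derived g); split; first exact: second_derived_subgroup.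
by move=> _ [p _ <-]; exact: commutators_second_derived.
Qed.

End Perfectness.

(** * Commutator length of powers *)

Section CommutatorLength.

Local Open Scope group_scope.

Lemma common_support
    (s : seq (derived_group braid_inf * derived_group braid_inf)) : exists N,
  forall p, p \in s -> between 0 N (val p.1) /\ between 0 N (val p.2).
Proof.
have support x : exists N, between 0 N x.
  have [w ->] := ev_surj x; have [n wn] := letters_bound w.
  by exists n.+1, w.
elim: s => [|p s [N IH]]; first by exists 0.
have [[N1 pN1] [N2 pN2]] := (support (val p.1), support (val p.2)).
exists (maxn N (maxn N1 N2)) => q; rewrite inE => /predU1P[->|/IH[q1 q2]].
  by split; [apply: between_sub pN1 | apply: between_sub pN2] => //; lia.
by split; [apply: between_sub q1 | apply: between_sub q2] => //; lia.
Qed.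

Lemma commutator_length_powers_bounded (g : derived_group braid_inf) :
  derived g -> exists m, forall k, (commutator_length (g ^+ k) <= m)%N.
Proof.
move=> /is_prod_of_commutatorsP[n /asboolP[s ->]].
have [N sN] := common_support s; exists (size s).+1 => k.
have [t /derived_lift[t' <-] disp] := displacement N k.
have subH : is_subgroup [set h : derived_group braid_inf | between 0 N (val h)].
  have [b1 bF] := between_subgroup 0 N; split=> [|x y]; [exact: b1 | exact: bF].
have := @power_of_commutators _ _ t' k subH _ s sN; set h := _ ^+ k.
move=> prodk; rewrite /commutator_length; case: pselect => // dh.
case: ex_minnP => m _; apply; apply/asboolP; apply: prodk => i x y ik xN yN.
have := disp i _ _ ik xN yN.
by rewrite -gmulfXn -gmulfJ /commute -!gmulfM => /val_inj.
Qed.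

End CommutatorLength.

(** * The quadratic form of a word *)

Section WordForm.

Variable F : realFieldType.

(** The intersection numbers of a chain of closed curves c_0, c_1, ... on a
  surface, where c_i meets only its neighbours, once each. The transvections
  along the c_i satisfy the braid relations: this is the reduced Burau
  representation at t = -1. *)
Definition omega (i j : nat) : F := (j == i.+1)%:R - (i == j.+1)%:R.

Lemma omegaC i j : omega j i = - omega i j.
Proof. by rewrite /omega opprB. Qed.

Lemma omega_self i : omega i i = 0.
Proof. exact: subrr. Qed.

Lemma omega_far i j : (i.+1 < j)%N -> omega i j = 0.
Proof.
move=> ij; rewrite /omega.
have -> : (j == i.+1) = false by lia.
have -> : (i == j.+1) = false by lia.
exact: subrr.
Qed.

Definition cross (V W : seq (letter * F)) : F :=
  \sum_(p <- V) \sum_(q <- W) omega p.1.1 q.1.1 * p.2 * q.2.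

Lemma cross_nil W : cross [::] W = 0.
Proof. exact: big_nil. Qed.

Lemma cross_catl U V W : cross (U ++ V) W = cross U W + cross V W.
Proof. exact: big_cat. Qed.

Lemma cross_consl p V W : cross (p :: V) W = cross [:: p] W + cross V W.
Proof. by rewrite -cat1s cross_catl. Qed.

Lemma crossC V W : cross W V = - cross V W.
Proof.
rewrite /cross exchange_big /= -sumrN; apply: eq_bigr => p _.
rewrite -sumrN; apply: eq_bigr => q _.
by rewrite omegaC !mulNr; congr (- _); ring.
Qed.

Lemma cross_catr U V W : cross U (V ++ W) = cross U V + cross U W.
Proof. by rewrite crossC cross_catl opprD -!crossC. Qed.

Lemma cross_nilr W : cross W [::] = 0.
Proof. by rewrite crossC cross_nil oppr0. Qed.

Lemma cross1l i b x W : cross [:: ((i, b), x)] W =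
  x * \sum_(q <- W) omega i q.1.1 * q.2.
Proof.
rewrite /cross big_seq1 mulr_sumr; apply: eq_bigr => q _ /=; ring.
Qed.

Lemma cross_letter i b x V W : cross (((i, b), x) :: V) W =
  x * \sum_(q <- W) omega i q.1.1 * q.2 + cross V W.
Proof. by rewrite cross_consl cross1l. Qed.

(** The form Q_w(x) = sum_k e_k x_k^2 + sum_(j < k) omega(i_j, i_k) x_j x_k,
  evaluated at a word whose letters carry the values x_k, where the k-th
  letter is s_(i_k) with exponent e_k. It is a generating form for the
  product of the transvections along the c_(i_k): its radical consists of
  the orbits v_0, ..., v_l = - v_0 of these transvections, with v_k =
  v_(k-1) + x_k c_(i_k). On the subspace where the values at each generator
  add up to zero, it is up to sign the symmetrised Seifert form of the
  closed braid. *)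
Fixpoint form (W : seq (letter * F)) : F :=
  if W is p :: W' then
    (-1) ^+ (~~ p.1.2) * p.2 ^+ 2 + cross [:: p] W' + form W'
  else 0.

Lemma form_cat V W : form (V ++ W) = form V + form W + cross V W.
Proof.
elim: V => [|p V IH] /=; first by rewrite cross_nil add0r addr0.
by rewrite IH cross_catr (cross_consl p V); ring.
Qed.

(** Since [cross] is skew, a factor of a word interacts with what precedes
  it and with what follows it through one and the same linear functional. *)
Lemma form_local M M' U V :
  form M = form M' -> (forall W, cross M W = cross M' W) ->
  form (U ++ M ++ V) = form (U ++ M' ++ V).
Proof.
move=> eM eC; rewrite !form_cat !cross_catr eM eC.
by rewrite (crossC M U) (crossC M' U) eC.
Qed.

Lemma form_swap i j b c x y U V : omega i j = 0 ->
  form (U ++ [:: ((i, b), x); ((j, c), y)] ++ V) =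
  form (U ++ [:: ((j, c), y); ((i, b), x)] ++ V).
Proof.
move=> ij; apply: form_local => [|W].
  by rewrite /= /cross !big_cons !big_nil /= (omegaC i j) ij; ring.
by rewrite ![cross [:: _; _] _]cross_consl addrC.
Qed.

(** The substitution (x, y, z) -> (x + y, x + z, - x) keeps the total value
  at each of the two generators, hence the interaction with the rest of the
  word; it also identifies the forms of the two triples. *)
Lemma form_braid i x y z U V :
  form (U ++ [:: ((i, true), x); ((i.+1, true), y); ((i, true), z)] ++ V) =
  form (U ++ [:: ((i.+1, true), x + y); ((i, true), x + z);
                 ((i.+1, true), - x)] ++ V).
Proof.
apply: form_local => [|W].
  rewrite /= /cross !big_cons !big_nil /= /omega !eqSS !eqxx.
  have -> : (i == i.+1) = false by lia.
  have -> : (i == i.+2) = false by lia.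
  by rewrite /nat_of_bool mulr1n mulr0n expr0; ring.
rewrite ![cross (_ :: [:: _; _]) _]cross_consl ![cross [:: _; _] _]cross_consl.
rewrite !cross1l; ring.
Qed.

Lemma form_braid' i x y z U V :
  form (U ++ [:: ((i.+1, true), x); ((i, true), y); ((i.+1, true), z)] ++ V) =
  form (U ++ [:: ((i, true), - z); ((i.+1, true), x + z);
                 ((i, true), y + z)] ++ V).
Proof. by rewrite form_braid (addrC x) (addrC y) !addKr opprK. Qed.

(** The rest of the word interacts with the pair only through x + y, so the
  whole dependence on the pair is x + y times an independent linear form: a
  hyperbolic plane. *)
Lemma form_cancel i b x y U V :
  form (U ++ [:: ((i, b), x); ((i, ~~ b), y)] ++ V) =
  form (U ++ V) + (x + y) * ((-1) ^+ (~~ b) * (x - y)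
    + \sum_(q <- V) omega i q.1.1 * q.2 - \sum_(q <- U) omega i q.1.1 * q.2).
Proof.
rewrite !form_cat !cross_catr (crossC _ U).
rewrite !(cross_consl (i, b, x) [:: _]) !cross1l /=.
rewrite cross1l !big_seq1 /= omega_self cross_nilr.
by case: b => /=; ring.
Qed.

(** Moving a block past the rest reverses the sign of their interaction,
  which negating the values on the block compensates. *)
Lemma form_rot V W :
  form (V ++ W) = form (W ++ [seq (q.1, - q.2) | q <- V]).
Proof.
have eC U : cross [seq (q.1, - q.2) | q <- V] U = - cross V U.
  rewrite /cross big_map -sumrN; apply: eq_bigr => p _.
  by rewrite -sumrN; apply: eq_bigr => q _ /=; ring.
have eF : forall U, form [seq (q.1, - q.2) | q <- U] = form U.
  elim=> [//|p U IH] /=; rewrite IH sqrrN; congr (_ + _ + _).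
  rewrite /cross !big_seq1 big_map; apply: eq_bigr => q _ /=; ring.
by rewrite !form_cat eF (crossC _ W) eC; ring.
Qed.

(** * The positive index of a word *)

Definition eval_at r (c : 'rV[F]_r) (D : seq (letter * 'cV[F]_r)) :=
  [seq (q.1, (c *m q.2) 0 0) | q <- D].

Lemma eval_at_cat r (c : 'rV[F]_r) D E :
  eval_at c (D ++ E) = eval_at c D ++ eval_at c E.
Proof. exact: map_cat. Qed.

(** The letters of [w] are labelled by linear forms in [r] variables, that
  is, by a linear map from F^r to the space of the form of [w]. The form
  pulled back by this map is to be positive definite; so [pos_rank w r] says
  that the positive index of the form of [w] is at least [r]. *)
Definition pos_rank (w : seq letter) (r : nat) : Prop :=
  exists2 D : seq (letter * 'cV[F]_r), unzip1 D = w &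
    forall c, c != 0 -> 0 < form (eval_at c D).

Lemma pos_rank0 w : pos_rank w 0.
Proof.
exists [seq (l, 0) | l <- w]; last by move=> c; rewrite thinmx0 eqxx.
by rewrite /unzip1 -map_comp map_id.
Qed.

Lemma unzip1_cat (T : Type) (D : seq (letter * T)) u v : unzip1 D = u ++ v ->
  exists D1 D2, [/\ D = D1 ++ D2, unzip1 D1 = u & unzip1 D2 = v].
Proof.
move=> e; exists (take (size u) D), (drop (size u) D).
rewrite cat_take_drop /unzip1 map_take map_drop [map _ _]e.
by rewrite take_size_cat // drop_size_cat.
Qed.

Lemma pos_rank_far u v i j r : omega i j = 0 ->
  pos_rank (u ++ [:: (i, true); (j, true)] ++ v) r ->
  pos_rank (u ++ [:: (j, true); (i, true)] ++ v) r.
Proof.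
move=> ij [D /unzip1_cat[U [E [-> eU /unzip1_cat[M [V [-> eM eV]]]]]] pD].
case: M eM pD => [|[l x] [|[l' y] [|//]]] //= [-> ->] pD.
exists (U ++ [:: ((j, true), y); ((i, true), x)] ++ V).
  by rewrite /unzip1 !map_cat -/unzip1 eU eV.
move=> c /pD; rewrite !eval_at_cat /=.
by rewrite (form_swap true true _ _ (eval_at c U) (eval_at c V) ij).
Qed.

Lemma pos_rank_braid u v i r :
  pos_rank (u ++ [:: (i, true); (i.+1, true); (i, true)] ++ v) r <->
  pos_rank (u ++ [:: (i.+1, true); (i, true); (i.+1, true)] ++ v) r.
Proof.
split=> -[D /unzip1_cat[U [E [-> eU /unzip1_cat[M [V [-> eM eV]]]]]] pD].
  case: M eM pD => [|[l x] [|[l' y] [|[l'' z] [|//]]]] //= [-> -> ->] pD.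
  exists (U ++ [:: ((i.+1, true), x + y); ((i, true), x + z);
                   ((i.+1, true), - x)] ++ V).
    by rewrite /unzip1 !map_cat -/unzip1 eU eV.
  move=> c /pD; rewrite !eval_at_cat /= form_braid.
  by rewrite !mulmxDr mulmxN !mxE.
case: M eM pD => [|[l x] [|[l' y] [|[l'' z] [|//]]]] //= [-> -> ->] pD.
exists (U ++ [:: ((i, true), - z); ((i.+1, true), x + z);
                 ((i, true), y + z)] ++ V).
  by rewrite /unzip1 !map_cat -/unzip1 eU eV.
move=> c /pD; rewrite !eval_at_cat /= form_braid'.
by rewrite !mulmxDr mulmxN !mxE.
Qed.

Lemma pos_rank_rot u v r : pos_rank (u ++ v) r -> pos_rank (v ++ u) r.
Proof.
case=> D /unzip1_cat[U [V [-> eU eV]]] pD.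
exists (V ++ [seq (q.1, - q.2) | q <- U]).
  by rewrite /unzip1 map_cat -map_comp -/unzip1 eU eV.
move=> c /pD; rewrite !eval_at_cat form_rot; congr (_ < form (_ ++ _)).
by rewrite /eval_at -!map_comp; apply: eq_map => q /=; rewrite mulmxN !mxE.
Qed.

Lemma pos_rank_rcons w l r : pos_rank w r -> pos_rank (rcons w l) r.
Proof.
case=> D eD pD; exists (rcons D (l, 0)); first by rewrite /unzip1 map_rcons -eD.
move=> c /pD; rewrite /eval_at map_rcons -!cats1 form_cat /=.
rewrite mulmx0 mxE expr0n /= mulr0 cross_nilr !addr0 crossC.
by case: l => i b; rewrite cross1l mul0r oppr0 addr0.
Qed.

(** A hyperbolic plane has positive index one: with one more variable t, the
  labels x and y of the new letters are chosen such that their contribution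
  is t^2. *)
Lemma pos_rank_insert u v i b r :
  pos_rank (u ++ v) r -> pos_rank (u ++ [:: (i, b); (i, ~~ b)] ++ v) r.+1.
Proof.
case=> D /unzip1_cat[U [V [-> eU eV]]] pD; rewrite -addn1.
pose beta (E : seq (letter * 'cV[F]_(r + 1))) :=
  \sum_(q <- E) omega i q.1.1 *: q.2.
pose up (E : seq (letter * 'cV[F]_r)) :=
  [seq (q.1, col_mx q.2 (0 : 'cV[F]_1)) | q <- E].
(* With x + y = e and x - y = d, both factors of the term added by the pair in
   [form_cancel] are equal to e, the new variable. *)
pose e : 'cV[F]_(r + 1) := col_mx 0 1.
pose s : F := (-1) ^+ (~~ b).
pose d := s *: (e - beta (up V) + beta (up U)).
exists (up U ++ [:: ((i, b), 2^-1 *: (e + d)); ((i, ~~ b), 2^-1 *: (e - d))]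
  ++ up V).
  by rewrite /unzip1 !map_cat -!map_comp -/unzip1 -eU -eV.
move=> c; rewrite -(hsubmxK c); move: (lsubmx c) (rsubmx c) => c' t ct0.
have eval_up E : eval_at (row_mx c' t) (up E) = eval_at c' E.
  rewrite /eval_at -map_comp; apply: eq_map => q /=.
  by rewrite mul_row_col mulmx0 addr0.
have eval_beta E : (row_mx c' t *m beta (up E)) 0 0
    = \sum_(q <- eval_at c' E) omega i q.1.1 * q.2.
  rewrite -eval_up big_map /beta mulmx_sumr summxE; apply: eq_bigr => q _.
  by rewrite -scalemxAr mxE.
have ee : (row_mx c' t *m e) 0 0 = t 0 0.
  by rewrite mul_row_col mulmx0 add0r mulmx1.
have linE (x y : 'cV[F]_(r + 1)) :
   (row_mx c' t *m (x + y)) 0 0 =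
   (row_mx c' t *m x) 0 0 + (row_mx c' t *m y) 0 0.
  by rewrite mulmxDr mxE.
have linN (x : 'cV[F]_(r + 1)) :
   (row_mx c' t *m (- x)) 0 0 = - (row_mx c' t *m x) 0 0.
  by rewrite mulmxN mxE.
have linZ a (x : 'cV[F]_(r + 1)) :
   (row_mx c' t *m (a *: x)) 0 0 = a * (row_mx c' t *m x) 0 0.
  by rewrite -scalemxAr mxE.
rewrite !eval_at_cat /= form_cancel !eval_up !(linZ, linE, linN, eval_beta, ee).
have s2 : s * s = 1 by rewrite -expr2 sqrr_sign.
set B := \sum_(q <- _) _; set A := \sum_(q <- _) _.
set t0 := t 0 0.
rewrite -/s -eval_at_cat.
have -> : (2^-1 * (t0 + s * (t0 - B + A)) + 2^-1 * (t0 - s * (t0 - B + A))) *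
  (s * (2^-1 * (t0 + s * (t0 - B + A)) - 2^-1 * (t0 - s * (t0 - B + A)))
    + B - A)
  = t0 ^+ 2.
  transitivity (t0 * ((s * s) * (t0 - B + A) + B - A)); first by field.
  by rewrite s2; ring.
have [c0|c0] := eqVneq c' 0; last by rewrite ltr_wpDr ?sqr_ge0 ?pD.
rewrite c0; have t00 : t0 != 0.
  apply: contraNneq ct0 => t00; rewrite c0; apply/eqP.
  rewrite (_ : t = 0) ?row_mx0 //; apply/matrixP => k l.
  by rewrite !ord1 mxE.
have -> : form (eval_at 0 (U ++ V)) = 0.
  elim: (U ++ V) => //= q E ->; rewrite mul0mx mxE expr0n mulr0 /=.
  by case: q.1 => k a; rewrite cross1l mul0r !addr0.
by rewrite add0r exprn_even_gt0.
Qed.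

Lemma kernel_of_covector r (d : 'cV[F]_r.+1) :
  exists2 K : 'M[F]_(r, r.+1), row_free K & K *m d = 0.
Proof.
have kr : (r <= \rank (kermx d))%N.
  by have := rank_leq_col d; rewrite mxrank_ker; lia.
exists (pid_mx r *m row_base (kermx d)).
  apply/inj_row_free => v.
  rewrite mulmxA; move/eqP; rewrite mulmx_free_eq0 ?row_base_free //.
  rewrite mulmx_free_eq0; first by move/eqP.
  by rewrite /row_free rank_pid_mx.
rewrite -mulmxA; have /sub_kermxP -> : (row_base (kermx d) <= kermx d)%MS.
  by rewrite eq_row_base.
exact: mulmx0.
Qed.

(** The contribution of the pair vanishes on the hyperplane x + y = 0. *)
Lemma pos_rank_cancel u v i b r :
  pos_rank (u ++ [:: (i, b); (i, ~~ b)] ++ v) r.+1 -> pos_rank (u ++ v) r.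
Proof.
case=> D /unzip1_cat[U [E [-> eU /unzip1_cat[M [V [-> eM eV]]]]]] pD.
case: M eM pD => [|[l x] [|[l' y] [|//]]] //= [-> ->] pD.
have [K Kfree Kd] := kernel_of_covector (x + y).
exists [seq (q.1, K *m q.2) | q <- U ++ V].
  by rewrite /unzip1 -map_comp map_cat -/unzip1 eU eV.
move=> c c0; have : c *m K != 0 by rewrite mulmx_free_eq0.
move/pD; rewrite !eval_at_cat /= form_cancel.
have -> : (c *m K *m x) 0 0 + (c *m K *m y) 0 0 = 0.
  transitivity ((c *m (K *m (x + y))) 0 0); last by rewrite Kd mulmx0 mxE.
  by rewrite mulmxA mulmxDr [RHS]mxE.
rewrite mul0r addr0 -eval_at_cat; congr (_ < form _).
by rewrite /eval_at -map_comp; apply: eq_map => q /=; rewrite mulmxA.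
Qed.

Lemma common_zero r (L : seq 'cV[F]_r) : (size L < r)%N ->
  exists2 c : 'rV[F]_r, c != 0 & {in L, forall d, c *m d = 0}.
Proof.
move=> Lr; pose A := \matrix_(i < r, j < size L) (nth 0 L j) i 0.
have : kermx A != 0.
  rewrite -mxrank_eq0 mxrank_ker subn_eq0 -ltnNge.
  exact: leq_ltn_trans (rank_leq_col A) Lr.
case/rowV0Pn => c /sub_kermxP cA c0; exists c => // d /(nthP 0)[k kL <-].
apply/matrixP => i j; rewrite !ord1 [RHS]mxE.
have /matrixP/(_ 0 (Ordinal kL)) := cA; rewrite !mxE => e.
by rewrite -[RHS]e; apply: eq_bigr => l _; rewrite mxE.
Qed.

End WordForm.

(** * The deficit of a braid *)

Section Deficit.

Variable F : realFieldType.

Definition negs (w : seq letter) := count (fun l => ~~ l.2) w.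

(** Inserting a cancelling pair adds one to the positive index and one to
  the number of negative letters. Their difference, the deficit, is thus
  unchanged, and [deficit_le w k] says that it is at most [k]. *)
Definition deficit_le (w : seq letter) (k : nat) : Prop :=
  exists2 r, (negs w <= r + k)%N & pos_rank F w r.

(** The surrounding words make the statement stable under concatenation of
  congruences. *)
Lemma deficit_context u v : pres_cong artin_nat u v ->
  forall a b k, deficit_le (a ++ u ++ b) k <-> deficit_le (a ++ v ++ b) k.
Proof.
elim=> {u v} [//|u v _ IH a b k|v u w _ IH1 _ IH2 a b k
  |u u' v v' _ IHu _ IHv a b k|i s a b k|u v].
- exact: iff_sym (IH _ _ _).
- exact: iff_trans (IH1 _ _ _) (IH2 _ _ _).
- rewrite -!catA; apply: iff_trans (IHu _ _ _) _; rewrite !(catA a).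
  exact: IHv.
- have nE : negs (a ++ [:: (i, s); (i, ~~ s)] ++ b) = (negs (a ++ b)).+1.
    by rewrite /negs !count_cat /=; case: s => /=; lia.
  rewrite /deficit_le cat0s nE; split=> -[r rk pr]; last first.
    by exists r.+1; [lia | exact: pos_rank_insert].
  (* Index 0 leaves fewer than [k] negative letters once the pair is removed. *)
  case: r rk pr => [|r] rk pr; first by exists 0; [lia | exact: pos_rank0].
  by exists r; [lia | exact: pos_rank_cancel pr].
case=> [i j ij|i] a b k; rewrite /deficit_le /negs !count_cat /=.
  split=> -[r rk pr]; exists r => //.
    exact: (@pos_rank_far F a b i j r (omega_far F ij) pr).
  apply: (@pos_rank_far F a b j i r _ pr).
  by rewrite omegaC omega_far ?oppr0.
split=> -[r rk pr]; exists r => //.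
  exact: (@pos_rank_braid F a b i r).1.
exact: (@pos_rank_braid F a b i r).2.
Qed.

Lemma deficit_cong u v k : pres_cong artin_nat u v ->
  deficit_le u k -> deficit_le v k.
Proof.
move=> uv; have := (deficit_context uv [::] [::] k).1.
by rewrite /= !cats0.
Qed.

Lemma deficit_rot u v k : deficit_le (u ++ v) k -> deficit_le (v ++ u) k.
Proof.
case=> r rk pr; exists r; last exact: pos_rank_rot.
by rewrite /negs count_cat addnC -count_cat.
Qed.

(** A new letter can be given the value 0, so it does not lower the positive
  index. *)
Lemma deficit_rcons w l k : deficit_le w k -> deficit_le (rcons w l) k.+1.
Proof.
case=> r rk pr; exists r; last exact: pos_rank_rcons.
by move: rk; rewrite /negs -cats1 count_cat /=; case: (~~ _); lia.
Qed.

(** By a rotation, multiplying by a conjugate of a letter amounts to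
  appending that letter to a conjugate of the original braid. *)
Lemma deficit_conj w (u : seq letter) l k : deficit_le w k ->
  deficit_le (w ++ wordV u ++ [:: l] ++ u) k.+1.
Proof.
move=> wk; pose u' : seq letter := wordV u.
have wk' : deficit_le ((w ++ u') ++ u) k.
  rewrite -catA; apply: deficit_cong wk; rewrite -[X in pres_cong _ X]cats0.
  by apply: PresCat; [exact: PresRefl | exact/PresSym/pres_Vmul].
have := deficit_rcons l (deficit_rot wk').
by rewrite -cats1 -catA => /deficit_rot; rewrite -!catA.
Qed.

Lemma deficit0 : deficit_le [::] 0.
Proof. by exists 0 => //; exact: pos_rank0. Qed.

(** * A word whose powers have linearly growing deficit *)

(** The positive letters spell (s_0^2 s_1^2)^2, and the values 1, 1, -1, -1,
  -1, -1, 1, 1 at them form a null vector. The negative letters s_3^-1,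
  which do not interact with s_0 and s_1, bring the exponent sum to zero. *)
Definition test_word : seq letter :=
  let a := [:: (0, true); (3, false)] in let b := [:: (1, true); (3, false)] in
  (a ++ a) ++ (b ++ b) ++ (a ++ a) ++ (b ++ b).

(** The null vector scaled by [x], with arbitrary values at the negative
  letters. *)
Definition test_block (x y1 y2 y3 y4 y5 y6 y7 y8 : F) : seq (letter * F) :=
  [:: ((0, true), x); ((3, false), y1); ((0, true), x); ((3, false), y2);
      ((1, true), - x); ((3, false), y3); ((1, true), - x); ((3, false), y4);
      ((0, true), - x); ((3, false), y5); ((0, true), - x); ((3, false), y6);
      ((1, true), x); ((3, false), y7); ((1, true), x); ((3, false), y8)].

Lemma form_test_block x y1 y2 y3 y4 y5 y6 y7 y8 :
  form (test_block x y1 y2 y3 y4 y5 y6 y7 y8) <= 0.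
Proof.
have -> : form (test_block x y1 y2 y3 y4 y5 y6 y7 y8) = - (y1 ^+ 2 + y2 ^+ 2 +
   y3 ^+ 2 + y4 ^+ 2 + y5 ^+ 2 + y6 ^+ 2 + y7 ^+ 2 + y8 ^+ 2).
  rewrite /= !cross1l !big_cons !big_nil /omega /= /nat_of_bool mulr1n mulr0n.
  by rewrite expr0 expr1; ring.
by rewrite oppr_le0 !addr_ge0 ?sqr_ge0.
Qed.

(** The null vector has total value zero at each generator, so it does not
  interact with other copies of the word. *)
Lemma cross_test_block x y1 y2 y3 y4 y5 y6 y7 y8 (W : seq (letter * F)) :
  all (fun q => q.1.1 \in [:: 0; 1; 3]%N) W ->
  cross (test_block x y1 y2 y3 y4 y5 y6 y7 y8) W = 0.
Proof.
move=> W013; have om3 : \sum_(q <- W) omega F 3 q.1.1 * q.2 = 0.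
  rewrite big_seq big1 // => q /(allP W013); rewrite !inE.
  by case/or3P=> /eqP ->; rewrite /omega /= subrr mul0r.
rewrite !cross_letter cross_nil om3; ring.
Qed.

(** In each copy of the word, seven linear conditions force the values at
  the eight positive letters to be proportional to the null vector. *)
Lemma form_test_word r p (D : seq (letter * 'cV[F]_r)) :
    unzip1 D = flatten (nseq p test_word) ->
  exists2 L : seq 'cV[F]_r, size L = (7 * p)%N &
    forall c : 'rV[F]_r, {in L, forall d, c *m d = 0} ->
      form (eval_at c D) <= 0.
Proof.
elim: p D => [|p IH] D; first by case: D => // _; exists [::].
move=> /unzip1_cat[M [E [-> eM eE]]]; have [L sL Lneg] := IH E eE.
case: M eM => [//|[l1 x1] [//|[k1 y1] [//|[l2 x2] [//|[k2 y2] M]]]].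
case: M => [//|[l3 x3] [//|[k3 y3] [//|[l4 x4] [//|[k4 y4] M]]]].
case: M => [//|[l5 x5] [//|[k5 y5] [//|[l6 x6] [//|[k6 y6] M]]]].
case: M => [//|[l7 x7] [//|[k7 y7] [//|[l8 x8] [//|[k8 y8] [|//]]]]].
case=> -> -> -> -> -> -> -> -> -> -> -> -> -> -> -> ->.
pose L0 := [:: x2 - x1; x3 + x1; x4 + x1; x5 + x1; x6 + x1; x7 - x1; x8 - x1].
exists (L0 ++ L).
  by rewrite size_cat sL /=; lia.
move=> c cL; rewrite eval_at_cat form_cat.
have /Lneg nE : {in L, forall d, c *m d = 0}.
  by move=> d dL; apply: cL; rewrite mem_cat dL orbT.
have eq_pm d s : d + s *: x1 \in L0 ->
    (c *m d) 0 0 = - s * (c *m x1) 0 0.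
  move=> dM; have /matrixP/(_ 0 0) : c *m (d + s *: x1) = 0.
    by apply: cL; rewrite mem_cat dM.
  by rewrite mulmxDr -scalemxAr !mxE; lra.
have eqp d : d + x1 \in L0 -> (c *m d) 0 0 = - (c *m x1) 0 0.
  by have := @eq_pm d 1; rewrite scale1r mulN1r.
have eqm d : d - x1 \in L0 -> (c *m d) 0 0 = (c *m x1) 0 0.
  by have := @eq_pm d (-1); rewrite scaleN1r opprK mul1r.
rewrite (_ : eval_at c _ = test_block ((c *m x1) 0 0) ((c *m y1) 0 0)
  ((c *m y2) 0 0) ((c *m y3) 0 0) ((c *m y4) 0 0) ((c *m y5) 0 0)
  ((c *m y6) 0 0) ((c *m y7) 0 0) ((c *m y8) 0 0)); last first.
  rewrite /eval_at /= (eqm x2) ?(eqp x3) ?(eqp x4) ?(eqp x5) ?(eqp x6)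
    ?(eqm x7) ?(eqm x8) //; by rewrite !inE eqxx ?orbT.
rewrite cross_test_block ?addr0.
  rewrite -[leRHS]addr0; apply: lerD => //; exact: form_test_block.
rewrite /eval_at all_map.
have : all (fun l => l.1 \in [:: 0; 1; 3]%N) (unzip1 E).
  by rewrite eE; elim: p {IH eE sL}.
by rewrite all_map.
Qed.

(** A positive definite subspace of dimension above 7p would contain a
  nonzero vector that satisfies the 7p linear conditions of
  [form_test_word]. *)
Lemma deficit_test_word p k :
  deficit_le (flatten (nseq p test_word)) k -> (p <= k)%N.
Proof.
case=> r rk [D eD pD]; have [L sL Lneg] := form_test_word eD.
have nE : negs (flatten (nseq p test_word)) = (8 * p)%N.
  by rewrite /negs count_flatten map_nseq sumn_nseq.
suff : (r <= 7 * p)%N by lia.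
rewrite leqNgt -sL; apply/negP => /common_zero[c c0 /Lneg].
by rewrite leNgt pD.
Qed.

End Deficit.

(** * The half-twist length *)

Section HalfTwistLength.

Local Open Scope group_scope.

Definition half_twists : set braid_inf :=
  [set x | exists l y, x = letter_ev l ^ y].

Lemma half_twistsV x : half_twists x -> half_twists x^-1.
Proof.
by move=> [l [y ->]]; exists (l.1, ~~ l.2), y; rewrite letter_evV conjVg.
Qed.

Lemma half_twistsJ x y : half_twists x -> half_twists (x ^ y).
Proof. by move=> [l [z ->]]; exists l, (z * y); rewrite conjgM. Qed.

Lemma half_twists_generate x : exists n, `[< prod_of half_twists n x >].
Proof.
have [w ->] := ev_surj x; exists (size w); apply/asboolP.
elim: w => [|l w IH]; first by rewrite ev_nil; exact: ProdOf0.
rewrite ev_cons -[size _]add1n; apply: prod_ofM => //; apply: prod_of1.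
by exists l, 1; rewrite conjg1.
Qed.

Definition half_twist_length x := ex_minn (half_twists_generate x).

Lemma half_twist_lengthP x : prod_of half_twists (half_twist_length x) x.
Proof. by rewrite /half_twist_length; case: ex_minnP => n /asboolP. Qed.

Lemma half_twist_length_min n x :
  prod_of half_twists n x -> (half_twist_length x <= n)%N.
Proof.
move=> xn; rewrite /half_twist_length; case: ex_minnP => m _; apply.
exact/asboolP.
Qed.

Lemma half_twist_lengthV x : half_twist_length x^-1 = half_twist_length x.
Proof.
have le z : (half_twist_length z^-1 <= half_twist_length z)%N.
  exact/half_twist_length_min/(prod_ofV half_twistsV)/half_twist_lengthP.
by apply/eqP; rewrite eqn_leq le -{1}(invgK x) le.
Qed.

Lemma half_twist_lengthJ x y : half_twist_length (x ^ y) = half_twist_length x.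
Proof.
have le z t : (half_twist_length (z ^ t) <= half_twist_length z)%N.
  exact/half_twist_length_min/(prod_ofJ half_twistsJ)/half_twist_lengthP.
by apply/eqP; rewrite eqn_leq le -{1}(conjgK y x) le.
Qed.

Lemma half_twist_lengthM x y :
  (half_twist_length (x * y) <= half_twist_length x + half_twist_length y)%N.
Proof.
exact/half_twist_length_min/prod_ofM/half_twist_lengthP/half_twist_lengthP.
Qed.

Lemma half_twist_length_eq0 x : half_twist_length x = 0 <-> x = 1.
Proof.
split=> [x0|->]; last first.
  by apply/eqP; rewrite -leqn0; apply/half_twist_length_min/ProdOf0.
have := half_twist_lengthP x; rewrite x0 => h; by inversion h.
Qed.

(** The empty word has deficit 0, and each conjugate of a letter adds at
  most one. *)
Lemma prod_of_deficit n x w : prod_of half_twists n x -> x = ev w ->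
  deficit_le rat w n.
Proof.
move=> xn; elim: xn w => [|m y _ my IH [l [z ->]]] w.
  by rewrite -ev_nil => /ev_cong/deficit_cong; apply; exact: deficit0.
have [[u eu] [v ev_v]] := (ev_surj y, ev_surj z).
rewrite eu ev_v => e; have {}e : ev (u ++ wordV v ++ [:: l] ++ v) = ev w.
  by rewrite -e !ev_cat ev_wordV ev_cons ev_nil mulg1 conjgE.
exact: deficit_cong (ev_cong e) (deficit_conj _ _ (IH _ eu)).
Qed.

(** The word is a product of four factors that are squares of quotients of
  two generators, and generators are conjugate. *)
Lemma test_element : exists g : derived_group braid_inf, val g = ev test_word.
Proof.
apply: derived_lift; rewrite /test_word !ev_cat.
have d i : derived (ev [:: (i, true); (3, false)]).
  by rewrite !ev_cons ev_nil mulg1; exact: gen_div_derived.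
by do ?[apply: derivedM]; exact: d.
Qed.

Lemma test_element_length p (g : derived_group braid_inf) :
  val g = ev test_word -> (p <= half_twist_length (val (g ^+ p)))%N.
Proof.
move=> eg; apply: (@deficit_test_word rat).
apply: prod_of_deficit (half_twist_lengthP _) _.
rewrite gmulfXn /= eg; elim: p => [|p IH]; first by rewrite ev_nil.
by rewrite expgS IH -ev_cat.
Qed.

End HalfTwistLength.

Theorem theorem1p13 (R : realType) :
  let G : groupType := derived_group braid_inf in
  [/\ finite_set [set: abelianisation G],
      forall g : G, derived g ->
        (fun k : nat => (commutator_length (g ^+ k)%g)%:R / k%:R : R) @ \oo --> 0
    & exists nu : G -> R,
        [/\ is_norm nu, conjugation_invariant nu & stably_unbounded nu]].
Proof.
move=> G; split.
- apply: (@sub_finite_set _ _ [set abel_one G]) => //; elim/quotW => x _ /=.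
  by apply/abel_piP; exact: derived_braid_inf_perfect.
- move=> g /commutator_length_powers_bounded[m gm]; exact: bounded_div_cvg0 gm.
pose nu (g : G) : R := (half_twist_length (val g))%:R.
have nuM g h : nu (g * h)%g <= nu g + nu h.
  by rewrite -natrD ler_nat half_twist_lengthM.
exists nu; split.
- split=> // [g|g].
    by rewrite /nu /= half_twist_lengthV.
  split=> [/eqP|->]; last by rewrite /nu (half_twist_length_eq0 _).2.
  by rewrite pnatr_eq0 => /eqP/half_twist_length_eq0 g1; exact: val_inj.
- move=> g h; rewrite /nu -(half_twist_lengthJ (val h) (val g)^-1).
  by rewrite conjgE invgK mulgA.
have [g eg] := test_element.
have [|m n|l ul] := @fekete R (fun p => nu (g ^+ p)%g); first by move=> n.
  by rewrite expgnDr nuM.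
exists g, l; split => //; rewrite gt_eqF // (@lt_le_trans _ _ 1) //.
have cvgu := cvgP _ ul; rewrite -(cvg_lim _ ul) //; apply: limr_ge => //.
near=> p; have p0 : (0 < p%:R :> R) by rewrite ltr0n; near: p; exists 1%N.
by rewrite ler_pdivlMr // mul1r ler_nat test_element_length.
Unshelve. all: by end_near. Qed.
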